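(* Let $p\in[1,2]$ and let $\mathcal{X}$ be a complex Banach space of Type-p, with Type-p constant $T_p(\mathcal{X})$. Let $\mathcal{M},\mathcal{N}\subseteq\mathcal{X}$ be subsets and let $A:\mathcal{M}\to\mathcal{X}$, $B:\mathcal{N}\to\mathcal{X}$ be (arbitrary) maps. Let $x\in\mathcal{M}\cap\mathcal{N}$ and $a,b\in\mathbb{C}$. Then for every $\phi\in\mathcal{X}^*$ satisfying $\|\phi\|\le 1$ and $\phi(x)=0$, $$\Delta_x(A,a)^p+\Delta_x(B,b)^p\ \ge\ \frac{1}{2\,T_p(\mathcal{X})^p}\left(|\phi((A+B)x)|^p+|\phi((A-B)x)|^p\right).$$
   Context: A Banach space $\mathcal{X}$ is of Type-p, $p\in[1,2]$, if there exists a constant $C>0$ such that for every $n\in\mathbb{N}$, $$\left(\frac{1}{2^n}\sum_{(\varepsilon_j)_{j=1}^n\in\{-1,1\}^n}\left\|\sum_{j=1}^n\varepsilon_jx_j\right\|^p\right)^{\frac1p}\le C\left(\sum_{j=1}^n\|x_j\|^p\right)^{\frac1p},\qquad\forall x_1,\dots,x_n\in\mathcal{X}.$$ The Type-p constant $T_p(\mathcal{X})$ is the infimum of all constants $C$ satisfying this inequality (for all $n$ and all $x_1,\dots,x_n$). $\mathcal{X}^*$ is the space of bounded linear functionals on $\mathcal{X}$ with the operator norm. The maps $A,B$ need not be linear, Lipschitz or continuous. For $A:\mathcal{M}\to\mathcal{X}$, $x\in\mathcal{M}$ and $a\in\mathbb{C}$, the uncertainty of $A$ at $x$ relative to $a$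 is $\Delta_x(A,a):=\|Ax-ax\|$ (similarly for $B$ on $\mathcal{N}$). For $x\in\mathcal{M}\cap\mathcal{N}$, $(A\pm B)x:=Ax\pm Bx$. *)

(* Defs.v *)
From HB Require Import structures.
From mathcomp Require Import all_boot all_order all_algebra.
From mathcomp Require Import complex.
From mathcomp Require Import all_classical all_reals all_analysis.

Set Implicit Arguments.
Unset Strict Implicit.
Unset Printing Implicit Defensive.

Import Order.TTheory GRing.Theory Num.Theory.
Import numFieldNormedType.Exports.

Local Open Scope classical_set_scope.
Local Open Scope ring_scope.
Local Open Scope complex_scope.

(* A complex Banach space is a completeNormedModType over R[i].  The norm
   `|v| then lives in R[i] (and is real, being nonnegative), whereas the real
   power _ `^ p and the infimum/supremum live in R, hence the real part. *)
Definition rnorm (R : realType) (V : normedZmodType R[i]) (v : V) : R :=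
  complex.Re `|v|.

Section TypeP.
Context {R : realType}.
Variables (X : normedModType R[i]) (p : R).

(* Signs are encoded by e : 'I_n -> bool, eps_j being (-1) ^+ e j. *)
Definition type_bound (C : R) : Prop :=
  forall (n : nat) (x : 'I_n -> X),
    ((2 ^+ n)^-1 * \sum_(e : {ffun 'I_n -> bool})
        rnorm (\sum_(j < n) ((-1) ^+ e j : R[i]) *: x j) `^ p) `^ p^-1
    <= C * (\sum_(j < n) rnorm (x j) `^ p) `^ p^-1.

Definition type_constants : set R := [set C | 0 < C /\ type_bound C].

Definition of_type : Prop := exists C : R, type_constants C.

Definition type_const : R := inf type_constants.

End TypeP.

Section Dual.
Context {R : realType} {X : normedModType R[i]}.

Definition bounded_functional (phi : {scalar X}) : Prop :=
  exists C : R, forall y : X, rnorm (phi y) <= C * rnorm y.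

(* [sup] is only meaningful on functionals that are bounded. *)
Definition dual_norm (phi : {scalar X}) : R :=
  sup [set rnorm (phi y) | y in [set y : X | rnorm y <= 1]].

End Dual.

Section PartialMaps.
Context {R : realType} {X : normedModType R[i]}.

(* A map on a subset M is a function on the subtype {x | x \in M}, to which
   the set M coerces. *)
Definition uncertainty (M : set X) (A : M -> X) (x : M) (a : R[i]) : R :=
  rnorm (A x - a *: val x).

Lemma val_in_setI_l (M N : set X) (x : M `&` N) : val x \in M.
Proof. by have := valP x; rewrite in_setI => /andP[]. Qed.

Lemma val_in_setI_r (M N : set X) (x : M `&` N) : val x \in N.
Proof. by have := valP x; rewrite in_setI => /andP[]. Qed.

Definition to_domI_l (M N : set X) (x : M `&` N) : M :=
  exist _ (val x) (val_in_setI_l x).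

Definition to_domI_r (M N : set X) (x : M `&` N) : N :=
  exist _ (val x) (val_in_setI_r x).

Definition add_domI (M N : set X) (A : M -> X) (B : N -> X) (x : M `&` N) : X :=
  A (to_domI_l x) + B (to_domI_r x).

Definition sub_domI (M N : set X) (A : M -> X) (B : N -> X) (x : M `&` N) : X :=
  A (to_domI_l x) - B (to_domI_r x).

End PartialMaps.

(* Main.v *)
(** Put [u = Ax - ax] and [v = Bx - bx].  Since [phi] kills [x] and has norm at
    most 1, [|phi ((A ± B) x)| = |phi (u ± v)| <= ‖u ± v‖].  The four signed
    sums of [u] and [v] are [± (u + v)] and [± (u - v)], so the Type-p
    inequality for two vectors reads
    [(‖u + v‖^p + ‖u - v‖^p) / 2 <= T_p^p (‖u‖^p + ‖v‖^p)]. *)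
Require Import Defs.
From mathcomp Require Import all_boot all_order all_algebra.
From mathcomp Require Import complex.
From mathcomp Require Import all_classical all_reals all_analysis.
Import Order.TTheory GRing.Theory Num.Theory.
Import numFieldNormedType.Exports.
Local Open Scope classical_set_scope.
Local Open Scope ring_scope.
Local Open Scope complex_scope.

Section RealNorm.
Context {R : realType}.

Lemma rnormE (V : normedZmodType R[i]) (v : V) : `|v| = (rnorm v)%:C.
Proof. by rewrite /rnorm RRe_real // ger0_real. Qed.

Lemma rnorm_ge0 (V : normedZmodType R[i]) (v : V) : 0 <= rnorm v.
Proof. by rewrite -ler0c -rnormE. Qed.

Lemma rnormN (V : normedZmodType R[i]) (v : V) : rnorm (- v) = rnorm v.
Proof. by rewrite /rnorm normrN. Qed.

Lemma rnorm0_eq0 (V : normedZmodType R[i]) (v : V) : rnorm v = 0 -> v = 0.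
Proof. by move=> v0; apply: normr0_eq0; rewrite rnormE v0. Qed.

Lemma rnormZ (X : normedModType R[i]) (c : R) (v : X) :
  0 <= c -> rnorm (c%:C *: v) = c * rnorm v.
Proof.
move=> c0; apply: complexI.
by rewrite -rnormE normrZ rmorphM /= -rnormE ger0_norm ?ler0c.
Qed.

Lemma rnormM (c : R) (z : R[i]) : 0 <= c -> rnorm (c%:C * z) = c * rnorm z.
Proof.
move=> c0; apply: complexI.
by rewrite -rnormE normrM rmorphM /= -rnormE ger0_norm ?ler0c.
Qed.

(** For nonzero [y], the quotient by [rnorm y] is the value of [rnorm] at the image of a unit
    vector, hence below the supremum; boundedness of [phi] makes that supremum meaningful. *)
Lemma rnorm_dual_le (X : normedModType R[i]) (phi : {scalar X}) (y : X) :
  bounded_functional phi -> rnorm (phi y) <= dual_norm phi * rnorm y.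
Proof.
move=> [C phiC]; have [y0|y0] := eqVneq (rnorm y) 0.
  by rewrite (rnorm0_eq0 _ _ y0) linear0 /rnorm !normr0 mulr0.
have y_gt0 : 0 < rnorm y by rewrite lt_def y0 rnorm_ge0.
have yV_ge0 : 0 <= (rnorm y)^-1 by rewrite invr_ge0 ltW.
rewrite -ler_pdivrMr // mulrC -rnormM // -linearZ /=.
apply: ub_le_sup; last first.
  by exists ((rnorm y)^-1%:C *: y) => //=; rewrite rnormZ // mulVf.
(* The sign of [C] is not given, so the upper bound on the unit ball is its absolute value. *)
exists `|C| => _ [z /= z1 <-]; apply: (le_trans (phiC z)).
apply: (@le_trans _ _ (`|C| * rnorm z)).
  by rewrite ler_wpM2r ?rnorm_ge0 ?ler_norm.
by rewrite ler_piMr.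
Qed.

End RealNorm.

(** A sign pattern on two indices is the pair of its values, so the sum reindexes over
    [bool * bool]. *)
Lemma sum_ffun_ord2_bool (V : nmodType) (F : bool -> bool -> V) :
  \sum_(e : {ffun 'I_2 -> bool}) F (e ord0) (e ord_max) =
  F true true + F true false + (F false true + F false false).
Proof.
rewrite (reindex (fun q : bool * bool =>
  [ffun i : 'I_2 => if i == ord0 then q.1 else q.2])) /=; last first.
  exists (fun e => (e ord0, e ord_max)) => [[q r] _|e _].
    by rewrite !ffunE.
  apply/ffunP => i; rewrite ffunE /=.
  case: eqP => [->//|]; case: i => -[|[|//]] i i0.
    by case: i0; exact: val_inj.
  by congr (e _); exact: val_inj.
under eq_bigr do rewrite !ffunE /=.
rewrite -(pair_bigA _ (fun q r => F q r)) /=.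
by rewrite big_bool /= !big_bool.
Qed.

Section TwoVectors.
Context {R : realType} (X : normedModType R[i]) (p : R).

(** Case n = 2 of the Type-p inequality: opposite sign patterns give equal norms, so the average of
    four terms is an average of two. *)
Lemma type_bound2 (C : R) (u v : X) : type_bound X p C ->
  (2^-1 * (rnorm (u + v) `^ p + rnorm (u - v) `^ p)) `^ p^-1 <=
  C * (rnorm u `^ p + rnorm v `^ p) `^ p^-1.
Proof.
move=> /(_ 2%N (fun i => if i == ord0 then u else v)).
rewrite !big_ord_recr big_ord0 /= add0r.
under eq_bigr do rewrite !big_ord_recr big_ord0 /= add0r.
have -> : widen_ord (leqnSn 1) ord_max = ord0 :> 'I_2 by exact: val_inj.
rewrite /= (sum_ffun_ord2_bool _ (fun q r =>
  rnorm ((-1) ^+ q *: u + (-1) ^+ r *: v) `^ p)) /=.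
rewrite !expr0 !expr1 !scaleN1r !scale1r.
rewrite -opprD rnormN (addrC (- u) v) -(opprB u v) rnormN.
rewrite (addrC (_ `^ p) (rnorm (u + v) `^ p)) addrACA.
set s := _ `^ p; set t := _ `^ p.
suff -> : (2 ^+ 2)^-1 * (s + s + (t + t)) = 2^-1 * (s + t) by [].
by rewrite -!mulr2n -mulrnDl -(mulr_natl (s + t)) mulrA expr2 invfM mulfVK.
Qed.

Lemma type_const_ge0 : 0 <= type_const X p.
Proof.
have [[C XC]|/set0P/negP/negPn/eqP X0] := pselect (type_constants X p !=set0).
  by apply: lb_le_inf; [exists C|move=> D [/ltW]].
(* Without admissible constants, the infimum takes its default value 0. *)
by rewrite /type_const X0 inf0.
Qed.

(** The two-vector bound passes from every admissible constant to their infimum, which need not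
    itself be admissible since it may be 0; raising to the power [p] then removes the roots. *)
Lemma type_const2 (u v : X) : 0 < p -> of_type X p ->
  rnorm (u + v) `^ p + rnorm (u - v) `^ p <=
  2 * type_const X p `^ p * (rnorm u `^ p + rnorm v `^ p).
Proof.
move=> p0 XT; set l := _ + _; set s := rnorm u `^ p + _.
have l0 : 0 <= l by rewrite addr_ge0 ?powR_ge0.
have s0 : 0 <= s by rewrite addr_ge0 ?powR_ge0.
have root : (2^-1 * l) `^ p^-1 <= type_const X p * s `^ p^-1.
  (* If the right-hand root vanishes, any single admissible constant suffices. Otherwise dividing by
     it gives a lower bound of all admissible constants. *)
  have [s_eq0|s_neq0] := eqVneq (s `^ p^-1) 0.
    by have [C [_ /(type_bound2 _ u v)]] := XT; rewrite -/l -/s s_eq0 !mulr0.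
  have s_gt0 : 0 < s `^ p^-1 by rewrite lt_def s_neq0 powR_ge0.
  rewrite -ler_pdivrMr //; apply: lb_le_inf => // C [_ /(type_bound2 _ u v)].
  by rewrite ler_pdivrMr.
have pK (y : R) : 0 <= y -> (y `^ p^-1) `^ p = y.
  by move=> y0; rewrite -powRrM mulVf ?gt_eqF // powRr1.
(* Both sides are written as [p]-th powers, so that [root] and monotonicity of the power
   conclude. *)
rewrite -mulrA -ler_pdivrMl // -(pK (_ * l)) ?mulr_ge0 // -(pK s) //.
rewrite -powRM ?type_const_ge0 ?powR_ge0 //.
apply: ge0_ler_powR root; first exact: ltW.
  by rewrite nnegrE powR_ge0.
by rewrite nnegrE mulr_ge0 ?powR_ge0 ?type_const_ge0.
Qed.

End TwoVectors.

Theorem theorem2p8 (R : realType) (p : R) (X : completeNormedModType R[i])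
  (hp : 1 <= p <= 2) (hX : of_type X p)
  (M N : set X) (A : M -> X) (B : N -> X) (x : M `&` N) (a b : R[i])
  (phi : {scalar X}) (phi_bounded : bounded_functional phi)
  (phi_le1 : dual_norm phi <= 1) (phi_x : phi (val x) = 0) :
  uncertainty A (to_domI_l x) a `^ p + uncertainty B (to_domI_r x) b `^ p >=
  1 / (2 * type_const X p `^ p) *
  (rnorm (phi (add_domI A B x)) `^ p + rnorm (phi (sub_domI A B x)) `^ p).
Proof.
have p0 : 0 < p by case/andP: hp => /(lt_le_trans ltr01).
rewrite /uncertainty /add_domI /sub_domI /=.
set y := A _; set z := B _; set u := y - a *: _; set v := z - b *: _.
have phi_le w : rnorm (phi w) `^ p <= rnorm w `^ p.
  have phiw : rnorm (phi w) <= rnorm w.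
    apply: (le_trans (rnorm_dual_le _ _ w phi_bounded)).
    by rewrite ler_piMl ?rnorm_ge0.
  by apply: ge0_ler_powR phiw; rewrite ?nnegrE ?rnorm_ge0 // ltW.
have phiu : phi u = phi y by rewrite linearB scalarZ phi_x mulr0 subr0.
have phiv : phi v = phi z by rewrite linearB scalarZ phi_x mulr0 subr0.
rewrite linearD linearB -phiu -phiv -linearD -linearB.
(* If [T_p = 0] (as for the zero space), the factor [1 / 0] is [0]. *)
have [T0|T_neq0] := eqVneq (type_const X p `^ p) 0.
  by rewrite T0 mulr0 invr0 mulr0 mul0r addr_ge0 ?powR_ge0.
have T_gt0 : 0 < 2 * type_const X p `^ p.
  by rewrite mulr_gt0 // lt_def T_neq0 powR_ge0.
rewrite div1r ler_pdivrMl //.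
apply: le_trans (type_const2 _ _ u v p0 hX).
(* [phi_le] is applied to [u + v] and to [u - v]. *)
by rewrite lerD.
Qed.
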